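(* Let $p>5$ be a prime. Then $$\sum_{k=1}^{p-1}\frac{H_k}{k\cdot 2^k}\equiv\frac{7}{24}pB_{p-3}\pmod{p^2}$$ and $$\sum_{k=1}^{p-1}\frac{H_{k,2}}{k\cdot 2^k}\equiv -\frac{3}{8}B_{p-3}\pmod{p}.$$
   Context: For positive integers $n,m$, $H_{n,m}=\sum_{k=1}^n \frac{1}{k^m}$ and $H_n=H_{n,1}=\sum_{k=1}^n\frac1k$. The Bernoulli numbers are defined by $B_0=1$ and $\sum_{k=0}^{n}\binom{n+1}{k}B_k=0$ for $n=1,2,3,\ldots$. Congruences modulo $p^e$ are between rational numbers whose denominators are prime to $p$: $a\equiv b\pmod{p^e}$ means that $a-b$ is $p^e$ times a rational number with denominator prime to $p$. *)

(* Defs.v *)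
From mathcomp Require Import all_boot all_order all_algebra.

Set Implicit Arguments.
Unset Strict Implicit.
Unset Printing Implicit Defensive.

Import Order.TTheory GRing.Theory Num.Theory.
Local Open Scope ring_scope.

Definition gen_harmonic (n m : nat) : rat :=
  \sum_(1 <= k < n.+1) 1 / (k%:R ^+ m).

Definition harmonic (n : nat) : rat := gen_harmonic n 1.

(* [bernoulli_seq n] is [:: B_0; ...; B_n.-1]: each new entry is obtained by
   solving \sum_(k < n.+1) 'C(n.+1, k) B_k = 0 for B_n, whose coefficient is
   'C(n.+1, n) = n.+1. *)
Fixpoint bernoulli_seq (n : nat) : seq rat :=
  if n is n'.+1 then
    let s := bernoulli_seq n' in
    rcons s (if n' == 0%N then 1
             else - (\sum_(k < n') 'C(n'.+1, k)%:R * s`_k) / n'.+1%:R)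
  else [::].

Definition bernoulli (n : nat) : rat := (bernoulli_seq n.+1)`_n.

Lemma size_bernoulli_seq n : size (bernoulli_seq n) = n.
Proof. by elim: n => //= n IHn; rewrite size_rcons IHn. Qed.

Lemma nth_bernoulli_seq n k : (k < n)%N -> (bernoulli_seq n)`_k = bernoulli k.
Proof.
elim: n => // n IHn; rewrite ltnS leq_eqVlt => /predU1P[-> //|lt_kn].
by rewrite /= nth_rcons size_bernoulli_seq lt_kn IHn.
Qed.

Lemma bernoulli0 : bernoulli 0 = 1.
Proof. by []. Qed.

Lemma bernoulli_rec n : (0 < n)%N ->
  \sum_(0 <= k < n.+1) 'C(n.+1, k)%:R * bernoulli k = 0.
Proof.
move=> n_gt0; rewrite big_mkord big_ord_recr /= binSn.
rewrite {2}/bernoulli /= nth_rcons size_bernoulli_seq ltnn eqxx.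
rewrite -[n == 0%N]negbK -lt0n n_gt0 /= mulrC divfK ?pnatr_eq0 //.
by under eq_bigr => k _ do rewrite -(@nth_bernoulli_seq n) //; rewrite subrr.
Qed.

Definition p_integral (p : nat) (x : rat) : Prop := coprime p `|denq x|.

(* Congruence modulo p ^ e is a relation between p-integral rationals, so both
   sides are required to be p-integral. *)
Definition rat_eqmod (p e : nat) (a b : rat) : Prop :=
  [/\ p_integral p a, p_integral p b
    & exists2 c : rat, p_integral p c & a - b = p%:R ^+ e * c].

(* Main.v *)
(* Write H_{n,m} for the harmonic sums, e_2(k) for the second elementary symmetric
   function of 1, ..., 1/k, h = (p-1)/2, and
     C = \sum_(i < p) H_{i-1} / i^2,  E = \sum_(i < p) (-1)^i H_{i-1} / i^2,
     S = \sum_(k < p) H_{k,2} / (k 2^k),  U = \sum_(k < p) H_k / (k^2 2^k).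
   Modulo p one has (-1)^k 'C(p-1, k) = 1, so the identities for binomial
   transforms become dualities exchanging z and 1 - z:
     \sum_j z^j H_{j-1,2} / j = \sum_i (1-z)^i H_{i-1} / i^2 - C,
     \sum_k z^k / k^3 = \sum_i (1-z)^i e_2(i-1) / i.
   The first one at z = 1/2 gives S = U - C; at z = 2, after the reflection
   k -> p - k, it gives 2 S = E - C. Reflection also gives 8 E = - H_{h,3}.
   The second one at z = 1/2 gives \sum_k e_2(k) / (k 2^k) = U.
   Expanding (-1)^k 'C(p-1, k) = 1 - p H_k + p^2 e_2(k) modulo p^3 in
     \sum_k (-1)^k 'C(p-1, k) z^k / k = \sum_i ((1-z)^i - 1) / i
   at z = 1 gives 3 H_{p-1} = - p^2 C modulo p^3, which through H_{p-1,2} yields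
   H_{h,3} = - 2 C modulo p; hence S = - 3/8 C and U = 5/8 C. At z = 1/2 it gives
   p \sum_k H_k / (k 2^k) = H_{p-1} + p^2 U modulo p^3, and 5/8 - 1/3 = 7/24.
   Finally C = B_{p-3} modulo p by Faulhaber's formula applied to
   H_{i-1} = \sum_(j < i) j^(p-2). *)

Require Import Defs.
From mathcomp Require Import all_boot all_order all_algebra.
From mathcomp Require Import ring zify.
Import GRing.Theory Num.Theory.
Local Open Scope ring_scope.

(** * Binomial transforms *)

Section BinomialTransform.

Variable F : fieldType.
Implicit Types (a b : nat -> F) (z : F).

(** Starting at [k = 1] admits sequences divided by [k]; hence the [- 1] in [bintrans_expr]. *)
Definition bintrans a n : F :=
  \sum_(1 <= k < n.+1) (-1) ^+ k * 'C(n, k)%:R * a k.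

Lemma eq_bintrans a b n :
  (forall k, (0 < k <= n)%N -> a k = b k) -> bintrans a n = bintrans b n.
Proof. by move=> eqab; apply: eq_big_nat => k kn; rewrite eqab. Qed.

(** By Pascal's rule and ['C(n, k) / k.+1 = 'C(n.+1, k.+1) / n.+1], passing from [n] to [n.+1] adds
    exactly the last summand. The bound [N] keeps the denominators invertible in characteristic
    p. *)
Lemma bintrans_div N a n :
    (forall m, (0 < m <= N)%N -> m%:R != 0 :> F) -> (n <= N)%N ->
  bintrans (fun k => a k / k%:R) n = \sum_(1 <= m < n.+1) bintrans a m / m%:R.
Proof.
move=> nz; elim: n => [|n IHn] nN; first by rewrite /bintrans !big_nil.
rewrite big_nat_recr //= -IHn 1?ltnW // /bintrans.
have -> : \sum_(1 <= k < n.+1) (-1) ^+ k * 'C(n, k)%:R * (a k / k%:R) =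
          \sum_(1 <= k < n.+2) (-1) ^+ k * 'C(n, k)%:R * (a k / k%:R).
  by rewrite [RHS]big_nat_recr //= bin_small // mulr0 mul0r addr0.
rewrite mulr_suml -big_split /= big_add1 [RHS]big_add1 /=.
apply: eq_big_nat => k /andP[_ kn].
have nk : k.+1%:R != 0 :> F by apply: nz; lia.
have nn : n.+1%:R != 0 :> F by apply: nz; lia.
have E : n.+1%:R * 'C(n, k)%:R = k.+1%:R * 'C(n.+1, k.+1)%:R :> F.
  by rewrite -!natrM (mul_bin_diag n.+1 k).
have H : 'C(n.+1, k.+1)%:R * a k.+1 / n.+1%:R = 'C(n, k)%:R * (a k.+1 / k.+1%:R) :> F.
  apply: (mulfI nn); rewrite [LHS]mulrC mulfVK // !mulrA E.
  by rewrite -(mulrC k.+1%:R^-1) !mulrA mulVf // mul1r.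
rewrite -!mulrA; rewrite -!mulrA in H; rewrite H binS natrD; ring.
Qed.

Lemma bintrans_expr z n : bintrans (fun k => z ^+ k) n = (1 - z) ^+ n - 1.
Proof.
rewrite exprDn -(big_mkord xpredT (fun i => 1 ^+ (n - i) * (- z) ^+ i *+ 'C(n, i))).
rewrite big_nat_recl // bin0 expr1n mulr1n mul1r expr0 addrAC subrr add0r.
rewrite /bintrans big_add1; apply: eq_big_nat => k _ /=.
by rewrite expr1n mul1r (exprNn z) -[RHS]mulr_natr mulrAC.
Qed.

(** Summation by parts: Pascal's rule leaves only the differences [b] of the partial sums, weighted
    by ['C(n, k)], which is [k.+1 / n.+1] times ['C(n.+1, k.+1)]. *)
Lemma bintrans_sum b n : n.+1%:R != 0 :> F ->
  bintrans (fun k => \sum_(1 <= j < k.+1) b j) n.+1 =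
  bintrans (fun k => k%:R * b k) n.+1 / n.+1%:R.
Proof.
move=> nn; pose c k := \sum_(1 <= j < k.+1) b j.
apply: (mulIf nn); rewrite mulfVK // -/c.
have c0 : c 0%N = 0 by rewrite /c big_geq.
have -> : bintrans c n.+1 = \sum_(0 <= k < n.+1) (-1) ^+ k.+1 * 'C(n, k)%:R * b k.+1.
  have -> : bintrans c n.+1 = \sum_(0 <= k < n.+1) (-1) ^+ k.+1 * 'C(n, k)%:R * c k.+1
     + \sum_(0 <= k < n.+1) (-1) ^+ k.+1 * 'C(n, k.+1)%:R * c k.+1.
    rewrite -big_split /bintrans big_add1 /=; apply: eq_big_nat => k _.
    by rewrite binS natrD; ring.
  have -> : \sum_(0 <= k < n.+1) (-1) ^+ k.+1 * 'C(n, k.+1)%:R * c k.+1 =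
            \sum_(0 <= k < n.+1) (-1) ^+ k * 'C(n, k)%:R * c k.
    rewrite big_nat_recr //= bin_small // mulr0 mul0r addr0.
    by rewrite [RHS]big_nat_recl //= c0 mulr0 add0r.
  rewrite -big_split /=; apply: eq_big_nat => k _.
  by rewrite /c [in X in X + _ = _]big_nat_recr //= exprS; ring.
rewrite /bintrans mulr_suml [RHS]big_add1 /=; apply: eq_big_nat => k _.
have E : n.+1%:R * 'C(n, k)%:R = k.+1%:R * 'C(n.+1, k.+1)%:R :> F.
  by rewrite -!natrM (mul_bin_diag n.+1 k).
transitivity ((-1) ^+ k.+1 * (n.+1%:R * 'C(n, k)%:R) * b k.+1); first by ring.
by rewrite E; ring.
Qed.

End BinomialTransform.

(** * Harmonic sums over a field *)

Section HarmonicSums.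

Variable F : fieldType.
Implicit Types (f g : nat -> F) (z : F) (n m N : nat).

(** Over [rat] this is [gen_harmonic]; the field is a parameter because the same sums are taken in
    characteristic p. *)
Definition hsum n m : F := \sum_(1 <= k < n.+1) 1 / k%:R ^+ m.

(* [esum2 n] and [esum3 n] are the elementary symmetric functions e_2 and e_3 of
   1, 1/2, ..., 1/n. *)
Definition esum2 n : F := \sum_(1 <= k < n.+1) hsum k.-1 1 / k%:R.

Definition esum3 n : F := \sum_(1 <= k < n.+1) esum2 k.-1 / k%:R.

Lemma hsum0 m : hsum 0 m = 0. Proof. by rewrite /hsum big_geq. Qed.

Lemma hsumS n m : hsum n.+1 m = hsum n m + 1 / n.+1%:R ^+ m.
Proof. by rewrite /hsum big_nat_recr. Qed.

Lemma esum2S n : esum2 n.+1 = esum2 n + hsum n 1 / n.+1%:R.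
Proof. by rewrite /esum2 big_nat_recr. Qed.

Lemma esum3S n : esum3 n.+1 = esum3 n + esum2 n / n.+1%:R.
Proof. by rewrite /esum3 big_nat_recr. Qed.

Lemma newton2 n : 2%:R * esum2 n = hsum n 1 ^+ 2 - hsum n 2.
Proof.
elim: n => [|n IHn]; first by rewrite /esum2 big_geq // !hsum0; ring.
by rewrite esum2S !hsumS mulrDr IHn !div1r -!exprVn; ring.
Qed.

Lemma newton3 n :
  6%:R * esum3 n = hsum n 1 ^+ 3 - 3%:R * hsum n 1 * hsum n 2 + 2%:R * hsum n 3.
Proof.
elim: n => [|n IHn]; first by rewrite /esum3 big_geq // !hsum0; ring.
rewrite esum3S mulrDr IHn.
have -> : 6%:R * (esum2 n / n.+1%:R) = 3%:R * (2%:R * esum2 n) / n.+1%:R by ring.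
by rewrite newton2 !hsumS !div1r -!exprVn; ring.
Qed.

(** The two sums are exchanged. The tail of [f] is written as total minus head because the totals
    met later vanish modulo p. *)
Lemma sum_by_parts f g n :
  \sum_(1 <= j < n.+1) f j * \sum_(1 <= i < j.+1) g i =
  \sum_(1 <= i < n.+1)
     g i * (\sum_(1 <= j < n.+1) f j - \sum_(1 <= j < i) f j).
Proof.
elim: n => [|n IHn]; first by rewrite !big_geq.
rewrite big_nat_recr //= IHn [RHS]big_nat_recr //=.
rewrite (big_nat_recr n.+1 1 f) //= (big_nat_recr n.+1 1 g) //=.
have -> : \sum_(1 <= i < n.+1)
     g i * (\sum_(1 <= j < n.+1) f j + f n.+1 - \sum_(1 <= j < i) f j) =
   \sum_(1 <= i < n.+1) g i * (\sum_(1 <= j < n.+1) f j - \sum_(1 <= j < i) f j)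
   + (\sum_(1 <= i < n.+1) g i) * f n.+1.
  by rewrite mulr_suml -big_split /=; apply: eq_bigr => i _; ring.
by ring.
Qed.

Lemma sum_even f n : \sum_(1 <= i < n.*2.+1) (1 + (-1) ^+ i) * f i =
  2%:R * \sum_(1 <= i < n.+1) f i.*2.
Proof.
elim: n => [|n IHn]; first by rewrite !big_geq ?mulr0.
rewrite doubleS big_nat_recr // big_nat_recr // IHn [in RHS]big_nat_recr //= doubleS.
rewrite -(signr_odd _ n.*2.+1) -(signr_odd _ n.*2.+2) /= odd_double /=.
by ring.
Qed.

Lemma bintrans_expr_div z N n :
    (forall m, (0 < m <= N)%N -> m%:R != 0 :> F) -> (n <= N)%N ->
  bintrans F (fun k => z ^+ k / k%:R) n =
  \sum_(1 <= i < n.+1) ((1 - z) ^+ i - 1) / i%:R.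
Proof.
move=> nz nN; rewrite (bintrans_div F N) //.
by apply: eq_big_nat => i _; rewrite bintrans_expr.
Qed.

Lemma bintrans_polylog3 z N n :
    (forall m, (0 < m <= N)%N -> m%:R != 0 :> F) -> (n <= N)%N ->
  bintrans F (fun k => z ^+ k / k%:R / k%:R / k%:R) n =
  \sum_(1 <= l < n.+1) (\sum_(1 <= j < l.+1)
     (\sum_(1 <= i < j.+1) ((1 - z) ^+ i - 1) / i%:R) / j%:R) / l%:R.
Proof.
move=> nz nN; rewrite (bintrans_div F N) //.
apply: eq_big_nat => l ln; rewrite (bintrans_div F N) //; last by lia.
congr (_ / _); apply: eq_big_nat => j jl.
by rewrite (bintrans_expr_div z N) //; lia.
Qed.

(** The two divisions by [k] become two outer sums; [bintrans_sum] then cancels the [j] under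
    [z ^+ j] and puts it back outside the transform. *)
Lemma bintrans_sum_expr z N n :
    (forall m, (0 < m <= N)%N -> m%:R != 0 :> F) -> (n <= N)%N ->
  bintrans F (fun k => (\sum_(1 <= j < k.+1) z ^+ j / j%:R) / k%:R / k%:R) n =
  \sum_(1 <= l < n.+1)
     (\sum_(1 <= j < l.+1) ((1 - z) ^+ j - 1) / j%:R / j%:R) / l%:R.
Proof.
move=> nz nN; rewrite (bintrans_div F N) //.
apply: eq_big_nat => l ln; rewrite (bintrans_div F N) //; last by lia.
congr (_ / _); apply: eq_big_nat => [[|j]] jl; first by lia.
rewrite bintrans_sum ?nz //; last by lia.
congr (_ / _ / _); rewrite -bintrans_expr; apply: eq_bintrans => k kj.
by rewrite mulrCA mulfV ?mulr1 // nz //; lia.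
Qed.

End HarmonicSums.

(** * Reflection of sums and Faulhaber's formula *)

Lemma sum_reflect (V : zmodType) (f : nat -> V) p :
  \sum_(1 <= k < p) f k = \sum_(1 <= k < p) f (p - k)%N.
Proof. by rewrite big_nat_rev; apply: eq_big_nat => k kp; congr f; lia. Qed.

(** Both products are the trinomial coefficient [n! / (r! s! (n-r-s)!)]. *)
Lemma mul_bin_swap n r s : (r + s <= n)%N ->
  ('C(n, r) * 'C(n - r, s) = 'C(n, s) * 'C(n - s, r))%N.
Proof.
move=> rs; apply/eqP.
rewrite -(eqn_pmul2r (_ : 0 < r`! * s`! * (n - r - s)`!)%N) ?muln_gt0 ?fact_gt0 //.
have -> : ('C(n, r) * 'C(n - r, s) * (r`! * s`! * (n - r - s)`!) =
  'C(n, r) * (r`! * ('C(n - r, s) * (s`! * (n - r - s)`!))))%N by ring.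
have -> : ('C(n, s) * 'C(n - s, r) * (r`! * s`! * (n - r - s)`!) =
  'C(n, s) * (s`! * ('C(n - s, r) * (r`! * (n - s - r)`!))))%N.
  by rewrite (subnAC n s r); ring.
by rewrite !bin_fact //; lia.
Qed.

(** Induction on [n]: the increment of the right side, expanded and with its sums exchanged, has
    inner sums that vanish by the recursion except at [s = M], which gives [M.+1 * n ^ M]. The
    recursion is asked only up to [M], so that the formula applies in characteristic p. *)
Lemma faulhaber (R : comNzRingType) (b : nat -> R) M :
    b 0%N = 1 ->
    (forall n, (0 < n <= M)%N ->
       \sum_(0 <= k < n.+1) 'C(n.+1, k)%:R * b k = 0) ->
  forall n, M.+1%:R * \sum_(0 <= j < n) j%:R ^+ M =
    \sum_(0 <= r < M.+1) 'C(M.+1, r)%:R * b r * n%:R ^+ (M.+1 - r).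
Proof.
move=> b0 brec; elim=> [|n IHn].
  rewrite big_geq // mulr0 big_nat big1 // => r rM.
  have -> : (M.+1 - r)%N = (M - r).+1 by lia.
  by rewrite exprS mul0r mulr0.
have diff e : n.+1%:R ^+ e = n%:R ^+ e + \sum_(0 <= s < e) 'C(e, s)%:R * n%:R ^+ s :> R.
  rewrite -addn1 natrD addrC exprDn -(big_mkord xpredT
     (fun i => 1 ^+ (e - i) * n%:R ^+ i *+ 'C(e, i))) big_nat_recr //=.
  rewrite binn expr1n mul1r mulr1n addrC; congr (_ + _).
  by apply: eq_bigr => s _; rewrite expr1n mul1r mulr_natl.
rewrite big_nat_recr //= mulrDr IHn; under [RHS]eq_bigr => r _ do rewrite diff mulrDr.
rewrite big_split /=; congr (_ + _).
have -> : \sum_(0 <= r < M.+1) 'C(M.+1, r)%:R * b r *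
     (\sum_(0 <= s < M.+1 - r) 'C(M.+1 - r, s)%:R * n%:R ^+ s) =
   \sum_(0 <= s < M.+1) 'C(M.+1, s)%:R * n%:R ^+ s *
     \sum_(0 <= r < M.+1 - s) 'C(M.+1 - s, r)%:R * b r.
  transitivity (\sum_(0 <= r < M.+1) \sum_(0 <= s < M.+1 | (r + s < M.+1)%N)
     'C(M.+1, s)%:R * n%:R ^+ s * ('C(M.+1 - s, r)%:R * b r)).
    apply: eq_big_nat => r rM; rewrite mulr_sumr.
    rewrite (big_nat_widen _ _ M.+1) ?leq_subr //=.
    apply: congr_big_nat => // s sM; first by lia.
    transitivity (('C(M.+1, r)%:R * 'C(M.+1 - r, s)%:R) * b r * n%:R ^+ s); first by ring.
    by rewrite -natrM mul_bin_swap ?natrM; [ring | lia].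
  under eq_bigr do rewrite big_mkcond.
  rewrite exchange_big_nat; apply: eq_big_nat => s sM; rewrite -big_mkcond.
  rewrite mulr_sumr [RHS](big_nat_widen _ _ M.+1) ?leq_subr //=.
  by apply: congr_big_nat => // r rM; lia.
rewrite big_nat_recr //= big_nat big1 ?add0r => [|s sM].
  by rewrite subSnn big_nat1 bin0 b0 !mulr1 binSn mulrC.
have -> : (M.+1 - s = (M - s).+1)%N by lia.
by rewrite brec ?mulr0 //; lia.
Qed.

(** * Harmonic sums in characteristic p *)

Section PrimeCharacteristic.

Variables (K : fieldType) (p : nat).
Hypotheses (pcharK : p \in [pchar K]) (p_gt5 : (5 < p)%N).
Implicit Types (f g : nat -> K) (z : K).

Notation hsum := (hsum K).
Notation esum2 := (esum2 K).
Notation esum3 := (esum3 K).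

Let p_prime : prime p := pcharf_prime pcharK.

Let pE : p.-1.+1 = p. Proof. by rewrite prednK // prime_gt0. Qed.

Let p_odd : odd p. Proof. by case: (even_prime p_prime) => // p2; lia. Qed.

Lemma natf_neq0_lt_char k : (0 < k < p)%N -> k%:R != 0 :> K.
Proof.
by move=> kp; rewrite -(dvdn_pcharf pcharK) gtnNdvd //; lia.
Qed.

Lemma natf_char_sub k : (k <= p)%N -> (p - k)%:R = - k%:R :> K.
Proof. by move=> kp; rewrite natrB // pcharf0 // sub0r. Qed.

Lemma natf_fermat n : n%:R ^+ p = n%:R :> K.
Proof. by rewrite -(pFrobenius_autE pcharK) pFrobenius_aut_nat. Qed.

(** Consecutive coefficients add up to ['C(p, k.+1)], a multiple of p, so they are opposite in
    [K]. *)
Lemma bin_pred_char k : (k < p)%N -> (-1) ^+ k * 'C(p.-1, k)%:R = 1 :> K.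
Proof.
elim: k => [|k IHk] kp; first by rewrite bin0 mulr1.
have E : 'C(p.-1, k.+1)%:R + 'C(p.-1, k)%:R = 0 :> K.
  rewrite -natrD -binS pE; apply/eqP; rewrite -(dvdn_pcharf pcharK).
  by rewrite prime_dvd_bin // kp.
rewrite -[RHS](IHk (ltnW kp)) exprS mulN1r mulNr -mulrN; congr (_ * _).
by apply/eqP; rewrite eq_sym -addr_eq0 addrC E.
Qed.

Lemma bintrans_pred_char f : bintrans K f p.-1 = \sum_(1 <= k < p) f k.
Proof.
rewrite /bintrans pE; apply: eq_big_nat => k kp.
by rewrite bin_pred_char ?mul1r //; lia.
Qed.

(** * Power sums and Bernoulli numbers in characteristic p *)

Section PowerSums.

(* [b] stands for the reduction of the Bernoulli numbers, whose recursion is only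
   meaningful in characteristic p below index p - 1. *)
Variable b : nat -> K.
Hypothesis b0 : b 0%N = 1.
Hypothesis b_rec : forall n, (0 < n < p.-1)%N ->
  \sum_(0 <= k < n.+1) 'C(n.+1, k)%:R * b k = 0.

(** In Faulhaber's formula at [n = p] every term contains a positive power of p. *)
Lemma power_sum_eq0 m : (0 < m < p.-1)%N -> \sum_(1 <= j < p) j%:R ^+ m = 0 :> K.
Proof.
move=> mp; have m1 : m.+1%:R != 0 :> K by apply: natf_neq0_lt_char; lia.
apply: (mulfI m1); rewrite mulr0.
have -> : \sum_(1 <= j < p) j%:R ^+ m = \sum_(0 <= j < p) j%:R ^+ m :> K.
  rewrite [RHS]big_ltn; last by lia.
  by rewrite expr0n; case: (m) mp => // k _; rewrite add0r.
rewrite (@faulhaber _ b m) // => [|n nm]; last by apply: b_rec; lia.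
rewrite big_nat big1 // => r rm; rewrite (pcharf0 pcharK).
by rewrite subSn ?exprS ?mul0r ?mulr0 //; lia.
Qed.

Lemma expf_pred_char k : (0 < k < p)%N -> k%:R ^+ p.-1 = 1 :> K.
Proof.
move=> kp; have k0 := natf_neq0_lt_char _ kp.
by apply: (mulfI k0); rewrite -exprS pE natf_fermat mulr1.
Qed.

Lemma hsum_pred_char m : (0 < m < p.-1)%N -> hsum p.-1 m = 0.
Proof.
move=> mp; rewrite /hsum pE -[RHS](power_sum_eq0 (p.-1 - m)); last by lia.
apply: eq_big_nat => k kp; have k0 := natf_neq0_lt_char _ kp.
have km : k%:R ^+ m != 0 :> K by rewrite expf_neq0.
by apply: (mulfI km); rewrite mulrC mulfVK // -exprD subnKC ?expf_pred_char //; lia.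
Qed.

(** Faulhaber's formula with [M = p - 2] expands [H_{i-1}] in powers of [i]; after division by
    [i ^ 2] and summation over [i], only the exponent 0, that is [r = p - 3], survives. *)
Lemma sum_hsum_bernoulli :
  \sum_(1 <= i < p) hsum i.-1 1 / i%:R ^+ 2 = b (p - 3).
Proof.
have p1 : p.-1%:R = -1 :> K by rewrite -subn1 natf_char_sub //; lia.
have p1n0 : p.-1%:R != 0 :> K by rewrite natf_neq0_lt_char; lia.
apply: (mulfI p1n0); rewrite mulr_sumr.
have H i : (0 < i < p)%N -> p.-1%:R * (hsum i.-1 1 / i%:R ^+ 2) =
   \sum_(0 <= r < p.-1) 'C(p.-1, r)%:R * b r * (i%:R ^+ (p.-1 - r) / i%:R ^+ 2).
  move=> ip; rewrite mulrA; under eq_bigr do rewrite mulrA.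
  have p2 : (p - 2).+1 = p.-1 by lia.
  rewrite -mulr_suml -p2 -(@faulhaber _ b) // => [|n np]; last by apply: b_rec; lia.
  congr (_ * _ * _); rewrite /hsum prednK; last by lia.
  (* The term [j = 0] of Faulhaber's sum is [0 ^ (p - 2) = 0]. *)
  rewrite [RHS]big_ltn; last by lia.
  have -> : (p - 2 = (p - 3).+1)%N by lia.
  rewrite exprS mul0r add0r; apply: eq_big_nat => k ki.
  have k0 : k%:R != 0 :> K by apply: natf_neq0_lt_char; lia.
  apply: (mulfI k0); rewrite expr1 div1r mulfV // -!exprS.
  have -> : (p - 3).+2 = p.-1 by lia.
  by rewrite expf_pred_char //; lia.
rewrite (eq_big_nat _ _ H) exchange_big_nat /=.
have -> : p.-1 = (p - 3).+2 by lia.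
(* The last two terms carry [i ^ 0] and [1 / i]; the others are power sums of exponent [p - 3 - r],
   between 1 and [p - 3]. *)
rewrite 2?big_nat_recr //= big_nat big1 => [|r rp].
  have -> : ((p - 3).+2 - (p - 3) = 2)%N by lia.
  have -> : ((p - 3).+2 - (p - 3).+1 = 1)%N by lia.
  have -> : (p - 3).+2 = p.-1 by lia.
  rewrite -2!mulr_sumr add0r.
  have -> : \sum_(1 <= i < p) i%:R ^+ 1 / i%:R ^+ 2 = hsum p.-1 1.
    rewrite /hsum pE; apply: eq_big_nat => i ip.
    by have i0 := natf_neq0_lt_char _ ip; field.
  have -> : \sum_(1 <= i < p) i%:R ^+ 2 / i%:R ^+ 2 = p.-1%:R :> K.
    rewrite -[RHS]mulr1 mulr_natl -subn1 -sumr_const_nat; apply: eq_big_nat => i ip.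
    by rewrite mulfV // expf_neq0 // natf_neq0_lt_char.
  have := bin_pred_char (p - 3) _; rewrite -signr_odd oddB ?p_odd //; last by lia.
  rewrite expr0 mul1r => ->; last by lia.
  by rewrite hsum_pred_char ?mulr0 ?addr0 1?mulrC ?mul1r //; lia.
rewrite -mulr_sumr -[RHS](mulr0 ('C((p - 3).+2, r)%:R * b r)); congr (_ * _).
rewrite -[RHS](power_sum_eq0 (p - 3 - r)); last by lia.
apply: eq_big_nat => i ip; have i0 := natf_neq0_lt_char _ ip.
have i20 : i%:R ^+ 2 != 0 :> K by rewrite expf_neq0.
by apply: (mulIf i20); rewrite mulfVK // -exprD; congr (_ ^+ _); lia.
Qed.

End PowerSums.

(** * Dualities between [z] and [1 - z], and the values at 1/2 *)

Section HarmonicDuality.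

Hypothesis hsum_pred : forall m, (0 < m < p.-1)%N -> hsum p.-1 m = 0.

(** Starting from [H_{p-1,m} = 0], terms [1 / (p-k)^m = (-1)^m / k^m] are removed one at a time. *)
Lemma hsum_reflect m k : (0 < m < p.-1)%N -> (0 < k <= p)%N ->
  hsum (p - k) m = - (-1) ^+ m * hsum k.-1 m.
Proof.
move=> mp; elim: k => // -[|k] IHk kp.
  by rewrite subn1 hsum_pred // hsum0 mulr0.
apply: (addIr (1 / (p - k.+1)%:R ^+ m)).
have Ek : (p - k.+1 = (p - k.+2).+1)%N by lia.
rewrite [in LHS]Ek -hsumS -Ek IHk ?hsumS; last by lia.
rewrite natf_char_sub; last by lia.
by rewrite (exprNn k.+1%:R) invfM -!exprVn invrN1; ring.
Qed.

Lemma esum2_pred : esum2 p.-1 = 0.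
Proof.
have n2 : 2%:R != 0 :> K by rewrite natf_neq0_lt_char; lia.
by apply: (mulfI n2); rewrite newton2 !hsum_pred; [ring | lia..].
Qed.

Lemma esum3_pred : esum3 p.-1 = 0.
Proof.
have n2 : 2%:R != 0 :> K by rewrite natf_neq0_lt_char; lia.
have n3 : 3%:R != 0 :> K by rewrite natf_neq0_lt_char; lia.
have n6 : 6%:R != 0 :> K by rewrite (natrM _ 2 3) mulf_neq0.
by apply: (mulfI n6); rewrite newton3 !hsum_pred; [ring | lia..].
Qed.

Lemma sum_by_parts_pred f g : \sum_(1 <= j < p) f j = 0 ->
  \sum_(1 <= j < p) f j * \sum_(1 <= i < j.+1) g i =
  - \sum_(1 <= i < p) g i * \sum_(1 <= j < i) f j.
Proof.
move=> f0; have := sum_by_parts K f g p.-1; rewrite pE f0 => ->.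
by rewrite -sumrN; apply: eq_bigr => i _; rewrite sub0r mulrN.
Qed.

Lemma hsum1E n : \sum_(1 <= j < n.+1) j%:R^-1 = hsum n 1.
Proof. by apply: eq_bigr => j _; rewrite expr1 div1r. Qed.

(** Both sides are, up to sign, the sum of [1 / k^2] times the partial sums of [z^j / j]: directly,
    by parts with [H_{p-1,2} = 0]; through the binomial transform, by parts with [H_{p-1} = 0]. *)
Lemma sum_expr_hsum2 z :
  \sum_(1 <= j < p) z ^+ j * hsum j.-1 2 / j%:R =
  \sum_(1 <= i < p) ((1 - z) ^+ i - 1) * hsum i.-1 1 / i%:R ^+ 2.
Proof.
have nz m : (0 < m <= p.-1)%N -> m%:R != 0 :> K.
  by move=> mp; apply: natf_neq0_lt_char; lia.
apply: oppr_inj.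
transitivity (\sum_(1 <= k < p) (\sum_(1 <= j < k.+1) z ^+ j / j%:R) / k%:R / k%:R).
  under [RHS]eq_bigr => k _ do rewrite -mulrA -expr2 exprVn mulrC -div1r.
  rewrite sum_by_parts_pred; last by rewrite -[in LHS]pE; apply: hsum_pred; lia.
  congr (- _); apply: eq_big_nat => -[|j] jp //.
  by rewrite -/(hsum j 2) /=; ring.
rewrite -bintrans_pred_char (bintrans_sum_expr K z p.-1) // pE.
under eq_bigr => k _ do rewrite mulrC.
rewrite sum_by_parts_pred; last by rewrite -[in LHS]pE hsum1E hsum_pred //; lia.
congr (- _); apply: eq_big_nat => -[|j] jp //.
by rewrite hsum1E -exprVn /=; ring.
Qed.

(** The transform yields a triple nested sum, unfolded by two summations by parts with vanishing
    totals [H_{p-1}] and [e_2(p-1)]. *)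
Lemma sum_expr_esum2 z :
  \sum_(1 <= k < p) z ^+ k / k%:R ^+ 3 =
  \sum_(1 <= i < p) (1 - z) ^+ i * esum2 i.-1 / i%:R.
Proof.
have nz m : (0 < m <= p.-1)%N -> m%:R != 0 :> K.
  by move=> mp; apply: natf_neq0_lt_char; lia.
transitivity (\sum_(1 <= k < p) z ^+ k / k%:R / k%:R / k%:R).
  by apply: eq_bigr => k _; rewrite -exprVn; ring.
rewrite -bintrans_pred_char (bintrans_polylog3 K z p.-1) // pE.
under eq_bigr => k _ do rewrite mulrC.
rewrite sum_by_parts_pred; last by rewrite -[in LHS]pE hsum1E hsum_pred //; lia.
have Ee n : \sum_(1 <= j < n.+1) hsum j.-1 1 / j%:R = esum2 n by [].
transitivity (- \sum_(1 <= j < p) (hsum j.-1 1 / j%:R) *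
   (\sum_(1 <= i < j.+1) ((1 - z) ^+ i - 1) / i%:R)).
  congr (- _); apply: eq_big_nat => -[|j] jp //.
  by rewrite hsum1E /=; ring.
rewrite sum_by_parts_pred; last by rewrite -[in LHS]pE Ee esum2_pred.
have := esum3_pred; rewrite /esum3 pE => e3.
(* The [- 1] in [(1 - z)^i - 1] contributes [- e_3(p-1) = 0]. *)
rewrite opprK -[RHS]subr0 -[X in _ = _ - X]e3 -sumrB.
by apply: eq_big_nat => -[|j] jp //; rewrite Ee /=; ring.
Qed.

Let x : K := 2%:R^-1.

Let n2 : 2%:R != 0 :> K. Proof. by rewrite natf_neq0_lt_char; lia. Qed.

Let C : K := \sum_(1 <= i < p) hsum i.-1 1 / i%:R ^+ 2.

Let E : K := \sum_(1 <= i < p) (-1) ^+ i * hsum i.-1 1 / i%:R ^+ 2.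

Let S : K := \sum_(1 <= k < p) hsum k 2 / (k%:R * 2%:R ^+ k).

Let U : K := \sum_(1 <= k < p) hsum k 1 / (k%:R ^+ 2 * 2%:R ^+ k).

(** The factor 2 comes from Fermat: [2^(p-k) = 2 / 2^k]. *)
Lemma sum_hsum2_alt : 2%:R * S = E - C.
Proof.
have -> : E - C = \sum_(1 <= i < p) ((1 - 2%:R) ^+ i - 1) * hsum i.-1 1 / i%:R ^+ 2.
  rewrite -sumrB; apply: eq_bigr => i _.
  by rewrite (_ : 1 - 2%:R = -1 :> K); ring.
rewrite -sum_expr_hsum2 /S sum_reflect mulr_sumr; apply: eq_big_nat => k kp.
rewrite hsum_reflect; [|lia|lia]; rewrite natf_char_sub; last by lia.
have k0 := natf_neq0_lt_char _ kp.
have e0 : 2%:R ^+ k != 0 :> K by rewrite expf_neq0.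
have -> : 2%:R ^+ (p - k) = 2%:R / 2%:R ^+ k :> K.
  by apply: (mulIf e0); rewrite mulfVK // -exprD subnK ?natf_fermat //; lia.
by field; rewrite oppr_eq0 k0 n2 e0.
Qed.

(** At the fixed point 1/2 of [1 - z], replacing [H_{k-1}] by [H_k] costs the same sum of
    [1 / (k^3 2^k)] on both sides. *)
Lemma sum_hsum2_hsum1 : S = U - C.
Proof.
have half : 1 - x = x by rewrite /x; field.
have T (u : K) k m : u / (k%:R ^+ m * 2%:R ^+ k) = x ^+ k * u / k%:R ^+ m.
  by rewrite invfM /x exprVn; ring.
have := sum_expr_hsum2 x; rewrite half.
have -> : \sum_(1 <= i < p) (x ^+ i - 1) * hsum i.-1 1 / i%:R ^+ 2 =
  U - \sum_(1 <= k < p) x ^+ k / k%:R ^+ 3 - C.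
  rewrite -!sumrB; apply: eq_big_nat => -[|k] kp //.
  by rewrite T hsumS div1r -!exprVn /=; ring.
have -> : \sum_(1 <= j < p) x ^+ j * hsum j.-1 2 / j%:R =
  S - \sum_(1 <= k < p) x ^+ k / k%:R ^+ 3.
  rewrite -!sumrB; apply: eq_big_nat => -[|k] kp //.
  by rewrite -[in RHS](expr1 k.+1%:R) T hsumS !div1r -!exprVn /=; ring.
by move=> H; rewrite -[S](subrK (\sum_(1 <= k < p) x ^+ k / k%:R ^+ 3)) H; ring.
Qed.

Lemma alternating_hsum1 : 8%:R * E = - hsum (p./2) 3.
Proof.
have E2 : 2%:R * E = - \sum_(1 <= i < p) (-1) ^+ i / i%:R ^+ 3.
  (* Since p is odd, reflection flips the sign [(-1)^i] and turns [H_{i-1}] into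
     [H_i = H_{i-1} + 1/i]. *)
  suff : E = - E - \sum_(1 <= i < p) (-1) ^+ i / i%:R ^+ 3.
    by move=> H; rewrite mulr_natl mulr2n {1}H; ring.
  rewrite {1}/E sum_reflect -sumrN -sumrB; apply: eq_big_nat => -[|k] kp //.
  have -> : ((p - k.+1).-1 = p - k.+2)%N by lia.
  rewrite hsum_reflect; [|lia|lia]; rewrite natf_char_sub; last by lia.
  have k0 := natf_neq0_lt_char _ kp.
  rewrite -signr_odd oddB; last by lia.
  rewrite p_odd -[in RHS]signr_odd /= hsumS.
  by move: k.+1%:R k0 => y y0; case: (odd k) => /=; field; rewrite oppr_eq0 y0.
(* Adding [H_{p-1,3} = 0] to the alternating sum leaves twice its even terms, [H_{h,3} / 4]. *)
have := sum_even K (fun i => 1 / i%:R ^+ 3) p./2.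
have -> : p./2.*2 = p.-1 by lia.
under eq_bigr do rewrite mulrDl mul1r.
rewrite big_split /= -/(hsum p.-1 3) hsum_pred ?add0r; last by lia.
rewrite pE => H.
have -> : 8%:R * E = 4%:R * (2%:R * E) by ring.
rewrite E2; under eq_bigr do rewrite -[(-1) ^+ _]mulr1 -mulrA.
rewrite H !mulrN mulrA mulr_sumr; congr (- _); apply: eq_big_nat => k kp.
have k0 : k%:R != 0 :> K by apply: natf_neq0_lt_char; lia.
rewrite -muln2 natrM; field; rewrite ?k0 ?n2 //.
Qed.

Lemma sum_esum2_hsum1 : \sum_(1 <= k < p) esum2 k / (k%:R * 2%:R ^+ k) = U.
Proof.
have half : 1 - x = x by rewrite /x; field.
have T (u : K) k m : u / (k%:R ^+ m * 2%:R ^+ k) = x ^+ k * u / k%:R ^+ m.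
  by rewrite invfM /x exprVn; ring.
have := sum_expr_esum2 x; rewrite half => H.
rewrite -[LHS](subrK (\sum_(1 <= k < p) x ^+ k / k%:R ^+ 3)) {1}H.
rewrite -sumrB -big_split /=; apply: eq_big_nat => -[|k] kp //.
by rewrite -[in LHS](expr1 k.+1%:R) !T esum2S hsumS !div1r -!exprVn /=; ring.
Qed.

(* This relation does not follow from the duality formulas; it is obtained by
   lifting to congruences modulo p^3. *)
Hypothesis hsum_half3 : hsum p./2 3 = - 2%:R * C.

Lemma sum_hsum2_eq : S = - (3%:R / 8%:R) * C.
Proof.
have n8 : 8%:R != 0 :> K by rewrite (natrX _ 2 3) expf_neq0.
have := alternating_hsum1; rewrite hsum_half3 => H.
(* Here [8 E = 2 C], so [8 (E - C) = - 6 C]. *)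
have H2 : 16%:R * S = - 6%:R * C.
  have -> : 16%:R * S = 8%:R * (2%:R * S) by ring.
  by rewrite sum_hsum2_alt mulrBr H; ring.
have n16 : 16%:R != 0 :> K by rewrite (natrX _ 2 4) expf_neq0.
by apply: (mulfI n16); rewrite H2; field.
Qed.

Lemma sum_esum2_eq :
  \sum_(1 <= k < p) esum2 k / (k%:R * 2%:R ^+ k) = 5%:R / 8%:R * C.
Proof.
have n8 : 8%:R != 0 :> K by rewrite (natrX _ 2 3) expf_neq0.
rewrite sum_esum2_hsum1 -[U](subrK C) -sum_hsum2_hsum1 sum_hsum2_eq.
by field.
Qed.

End HarmonicDuality.

End PrimeCharacteristic.

(** * Reduction of p-integral rationals *)

Section Reduction.

Variables (K : fieldType) (p : nat).
Hypothesis pcharK : p \in [pchar K].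

Let p_prime : prime p := pcharf_prime pcharK.

Let natf_neq0_coprime d : coprime p d -> d%:R != 0 :> K.
Proof. by rewrite -(dvdn_pcharf pcharK) prime_coprime. Qed.

Let natq_neq0_coprime d : coprime p d -> d%:R != 0 :> rat.
Proof.
rewrite pnatr_eq0 => pd; apply/eqP => d0; move: pd.
by rewrite d0 /coprime gcdn0 => /eqP p1; move: p_prime; rewrite p1.
Qed.

(** In characteristic p, [ratr] respects sums and products on p-integral rationals; hence
    integrality is bundled with the value. *)
Definition reduces (x : rat) (y : K) := p_integral p x /\ ratr x = y.

(** Fractions need not be in lowest terms here, which makes closure under ring operations direct. *)
Lemma reducesP x y :
  reduces x y <-> exists (a : int) d,
    [/\ coprime p d, x = a%:~R / d%:R & y = a%:~R / d%:R].
Proof.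
split=> [[px <-]|[a] [d] [pd -> ->]].
  by exists (numq x), `|denq x|%N; rewrite !pmulrn absz_denq divq_num_den.
set q : rat := a%:~R / d%:R.
have qd : numq q * d%:Z = a * denq q.
  apply: (@intr_inj rat); rewrite !rmorphM /= numqE -pmulrn mulrAC.
  by rewrite mulfVK // natq_neq0_coprime.
have dq : (`|denq q| %| d)%N.
  rewrite -(@Gauss_dvdr _ `|numq q|); last by rewrite coprime_sym coprime_num_den.
  by rewrite -[d]absz_nat -abszM qd abszM dvdn_mull.
have pq : coprime p `|denq q| by apply: coprime_dvdr pd.
split=> //; rewrite /ratr -[denq q]absz_denq -pmulrn.
apply/eqP; rewrite eqr_div ?natf_neq0_coprime //; apply/eqP.
by rewrite !pmulrn absz_denq -!rmorphM qd.
Qed.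

Lemma reduces_frac a d : coprime p d -> reduces (a%:~R / d%:R) (a%:~R / d%:R).
Proof. by move=> pd; apply/reducesP; exists a, d. Qed.

Lemma p_integral_reduces x : p_integral p x -> reduces x (ratr x).
Proof. by []. Qed.

Lemma reduces_nat n : reduces n%:R n%:R.
Proof. by have := @reduces_frac n 1 (coprimen1 _); rewrite !divr1. Qed.

Lemma reducesV_nat n : coprime p n -> reduces n%:R^-1 n%:R^-1.
Proof. by move=> pn; have := @reduces_frac 1 n pn; rewrite !mul1r. Qed.

Lemma reducesD x y x' y' :
  reduces x y -> reduces x' y' -> reduces (x + x') (y + y').
Proof.
move=> /reducesP[a [d [pd -> ->]]] /reducesP[a' [d' [pd' -> ->]]].
apply/reducesP; exists (a * d'%:Z + a' * d%:Z), (d * d')%N.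
rewrite coprimeMr pd pd' !rmorphD !rmorphM ?natrM /= -!pmulrn; split=> //.
  by field; rewrite !natq_neq0_coprime.
by field; rewrite !natf_neq0_coprime.
Qed.

Lemma reducesM x y x' y' :
  reduces x y -> reduces x' y' -> reduces (x * x') (y * y').
Proof.
move=> /reducesP[a [d [pd -> ->]]] /reducesP[a' [d' [pd' -> ->]]].
apply/reducesP; exists (a * a'), (d * d')%N.
by rewrite coprimeMr pd pd' !rmorphM ?natrM /= !mulf_div.
Qed.

Lemma reducesN x y : reduces x y -> reduces (- x) (- y).
Proof.
move=> /reducesP[a [d [pd -> ->]]].
by rewrite -!mulNr -!rmorphN; apply: reduces_frac.
Qed.

Lemma reducesB x y x' y' :
  reduces x y -> reduces x' y' -> reduces (x - x') (y - y').
Proof. by move=> rx rx'; apply/reducesD/reducesN. Qed.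

Lemma reducesX x y n : reduces x y -> reduces (x ^+ n) (y ^+ n).
Proof.
move=> rx; elim: n => [|n IHn]; first by rewrite !expr0; apply: reduces_nat 1%N.
by rewrite !exprS; apply: reducesM.
Qed.

Lemma reduces_sum m n (f : nat -> rat) (g : nat -> K) :
  (forall i, (m <= i < n)%N -> reduces (f i) (g i)) ->
  reduces (\sum_(m <= i < n) f i) (\sum_(m <= i < n) g i).
Proof.
move=> fg; rewrite big_nat [X in reduces _ X]big_nat; elim/big_rec2: _ => [|i y x mi].
  exact: reduces_nat 0%N.
by apply: reducesD; apply: fg.
Qed.

(** This converts vanishing in [K] into divisibility by p, and back. *)
Lemma reduces0P x : reduces x 0 <-> p_integral p (x / p%:R).
Proof.
have p0 : p%:R != 0 :> rat by rewrite pnatr_eq0 -lt0n prime_gt0.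
split=> [/reducesP[a [d [pd -> /eqP]]]|px].
  rewrite eq_sym mulf_eq0 invr_eq0 (negPf (natf_neq0_coprime _ pd)) orbF.
  have -> : (a%:~R == 0 :> K) = (p %| `|a|)%N.
    rewrite (dvdn_pcharf pcharK); case: a => n; rewrite ?NegzE ?rmorphN ?oppr_eq0 //.
  case/dvdnP => k ak.
  have -> : a%:~R / d%:R / p%:R = ((-1) ^+ (a < 0)%R * k%:Z)%:~R / d%:R :> rat.
    rewrite [in LHS](intEsign a) ak PoszM !rmorphM /= -!pmulrn.
    by field; rewrite p0 natq_neq0_coprime.
  by case: (reduces_frac ((-1) ^+ (a < 0)%R * k%:Z) d pd).
have -> : x = x / p%:R * p%:R by rewrite mulfVK.
rewrite -(mulr0 (ratr (x / p%:R))) -(pcharf0 pcharK).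
by apply: reducesM (reduces_nat _); apply: p_integral_reduces.
Qed.

End Reduction.

(** * Congruences modulo powers of p *)

Section HarmonicCongruences.

Variables (K : fieldType) (p : nat).
Hypotheses (pcharK : p \in [pchar K]) (p_gt5 : (5 < p)%N).

Notation reduces := (reduces K p).

Let p_prime : prime p := pcharf_prime pcharK.

Let p_neq0 : p%:R != 0 :> rat. Proof. by rewrite pnatr_eq0; lia. Qed.

Let natq_neq0 k : (0 < k)%N -> k%:R != 0 :> rat.
Proof. by rewrite pnatr_eq0; lia. Qed.

Let pE : p.-1.+1 = p. Proof. by lia. Qed.

Let p_odd : odd p. Proof. by case: (even_prime p_prime) => // p2; lia. Qed.

Lemma coprime_lt_prime k : (0 < k < p)%N -> coprime p k.
Proof. by move=> kp; rewrite prime_coprime // gtnNdvd //; lia. Qed.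

Lemma p_integral_nat n : p_integral p n%:R.
Proof. by case: (reduces_nat K p pcharK n). Qed.

Lemma p_integralV k : (0 < k < p)%N -> p_integral p k%:R^-1.
Proof. by move=> kp; case: (reducesV_nat K p pcharK k (coprime_lt_prime k kp)). Qed.

Lemma p_integralD x y : p_integral p x -> p_integral p y -> p_integral p (x + y).
Proof.
by move=> ix iy; case: (reducesD K p pcharK x (ratr x) y (ratr y)).
Qed.

Lemma p_integralN x : p_integral p x -> p_integral p (- x).
Proof. by move=> ix; case: (reducesN K p pcharK x (ratr x)). Qed.

Lemma p_integralB x y : p_integral p x -> p_integral p y -> p_integral p (x - y).
Proof. by move=> ix iy; apply/p_integralD/p_integralN. Qed.

Lemma p_integralM x y : p_integral p x -> p_integral p y -> p_integral p (x * y).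
Proof.
by move=> ix iy; case: (reducesM K p pcharK x (ratr x) y (ratr y)).
Qed.

Lemma p_integralX x n : p_integral p x -> p_integral p (x ^+ n).
Proof. by move=> ix; case: (reducesX K p pcharK x (ratr x) n). Qed.

Lemma p_integral_sum m n (f : nat -> rat) :
  (forall i, (m <= i < n)%N -> p_integral p (f i)) ->
  p_integral p (\sum_(m <= i < n) f i).
Proof.
by move=> fi; case: (reduces_sum K p pcharK m n f (fun i => ratr (f i))) => // i /fi.
Qed.

Lemma reducesV_lt k : (0 < k < p)%N -> reduces k%:R^-1 k%:R^-1.
Proof. by move=> kp; apply: reducesV_nat => //; apply: coprime_lt_prime. Qed.

Lemma reduces_hsum n m : (n < p)%N -> reduces (hsum rat n m) (hsum K n m).
Proof.
move=> np; apply: reduces_sum => // k kn; rewrite !div1r -!exprVn.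
by apply: reducesX => //; apply: reducesV_lt; lia.
Qed.

Lemma reduces_esum2 n : (n < p)%N -> reduces (esum2 rat n) (esum2 K n).
Proof.
move=> np; apply: reduces_sum => // k kn; apply: reducesM => //.
  by apply: reduces_hsum; lia.
by apply: reducesV_lt; lia.
Qed.

Lemma reduces_esum3 n : (n < p)%N -> reduces (esum3 rat n) (esum3 K n).
Proof.
move=> np; apply: reduces_sum => // k kn; apply: reducesM => //.
  by apply: reduces_esum2; lia.
by apply: reducesV_lt; lia.
Qed.

(** Solving the recursion for [B_n] divides only by [n.+1], which is below p. *)
Lemma reduces_bernoulli n : (n < p.-1)%N ->
  reduces (bernoulli n) (ratr (bernoulli n)).
Proof.
move=> np; split=> //; elim/ltn_ind: n np => n IHn np.
case: (posnP n) => [->|n0]; first by rewrite bernoulli0; apply: p_integral_nat 1%N.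
have := bernoulli_rec n0; rewrite big_nat_recr //= binSn => /eqP.
rewrite addr_eq0 => /eqP H.
have -> : bernoulli n = - (\sum_(0 <= k < n) 'C(n.+1, k)%:R * bernoulli k) * n.+1%:R^-1.
  by rewrite H opprK mulrAC mulfV ?mul1r // natq_neq0.
apply: p_integralM; last by apply: p_integralV; lia.
apply/p_integralN/p_integral_sum => k kn; apply: p_integralM.
  exact: p_integral_nat.
by apply: IHn; lia.
Qed.

Let b n : K := ratr (bernoulli n).

Let b0 : b 0%N = 1. Proof. by rewrite /b bernoulli0 (ratr_nat K 1). Qed.

Lemma ratr_bernoulli_rec n : (0 < n < p.-1)%N ->
  \sum_(0 <= k < n.+1) 'C(n.+1, k)%:R * b k = 0.
Proof.
move=> np.
have [_ <-] : reduces (\sum_(0 <= k < n.+1) 'C(n.+1, k)%:R * bernoulli k)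
                      (\sum_(0 <= k < n.+1) 'C(n.+1, k)%:R * b k).
  apply: reduces_sum => // k kn; apply: reducesM => //; first exact: reduces_nat.
  by apply: reduces_bernoulli; lia.
by rewrite bernoulli_rec ?(ratr_nat K 0) //; lia.
Qed.

Let hsum_pred m : (0 < m < p.-1)%N -> hsum K p.-1 m = 0.
Proof. exact: (hsum_pred_char K p pcharK p_gt5 b b0 ratr_bernoulli_rec). Qed.

Let p_lt : (p.-1 < p)%N. Proof. by lia. Qed.

Lemma p_integral_hsum_div m : (0 < m < p.-1)%N -> p_integral p (hsum rat p.-1 m / p%:R).
Proof.
move=> mp; apply/(reduces0P K p pcharK); rewrite -(hsum_pred m) //.
exact: reduces_hsum.
Qed.

Lemma p_integral_esum3_div : p_integral p (esum3 rat p.-1 / p%:R).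
Proof.
apply/(reduces0P K p pcharK); rewrite -(esum3_pred K p pcharK p_gt5 hsum_pred).
exact: reduces_esum3.
Qed.

Let Cq : rat := \sum_(1 <= i < p) hsum rat i.-1 1 / i%:R ^+ 2.

(* From here on, a congruence x = 0 modulo p^e is stated as the p-integrality of
   x / p^e. *)
Lemma hsum1_hsum2_congr :
  p_integral p ((2%:R * hsum rat p.-1 1 + p%:R * hsum rat p.-1 2) / p%:R ^+ 3).
Proof.
(* Summed over [k], this is the exact expansion [1/(p-k) = - 1/k - p/k^2 - p^2/k^3 + p^3/(k^3
   (p-k))]. *)
have -> : (2%:R * hsum rat p.-1 1 + p%:R * hsum rat p.-1 2) / p%:R ^+ 3 =
   \sum_(1 <= k < p) k%:R^-1 ^+ 3 * (p - k)%:R^-1 - hsum rat p.-1 3 / p%:R.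
  apply: (mulIf (expf_neq0 3 p_neq0)); rewrite mulfVK ?expf_neq0 //.
  have -> : 2%:R * hsum rat p.-1 1 = \sum_(1 <= k < p) (k%:R^-1 + (p - k)%:R^-1).
    rewrite big_split /= -(sum_reflect _ (fun k => k%:R^-1)) /hsum pE mulr_natl mulr2n.
    by congr (_ + _); apply: eq_bigr => k _; rewrite expr1 div1r.
  rewrite mulrBl.
  have -> : hsum rat p.-1 3 / p%:R * p%:R ^+ 3 = p%:R ^+ 2 * hsum rat p.-1 3 by field.
  rewrite /hsum pE mulr_suml !mulr_sumr -sumrB -big_split /=; apply: eq_big_nat => k kp.
  have k0 : k%:R != 0 :> rat by apply: natq_neq0; lia.
  have := natq_neq0 (p - k); rewrite natrB; last by lia.
  by move=> /(_ ltac:(lia)) pk0; field; rewrite k0 pk0.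
apply: p_integralB; last by apply: p_integral_hsum_div; lia.
apply: p_integral_sum => k kp; apply: p_integralM; last by apply: p_integralV; lia.
by apply/p_integralX/p_integralV; lia.
Qed.

(* The third-order remainder of (-1)^k 'C(p-1, k) = \prod_(j <= k) (1 - p/j). *)
Let D k : rat := ((-1) ^+ k * 'C(p.-1, k)%:R - 1 + p%:R * hsum rat k 1
                  - p%:R ^+ 2 * esum2 rat k) / p%:R ^+ 3.

Lemma p_integral_bin_expansion k : (k < p)%N -> p_integral p (D k).
Proof.
elim: k => [|k IHk] kp.
  have -> : D 0 = 0.
    by rewrite /D bin0 hsum0 /esum2 big_geq //; ring.
  exact: p_integral_nat 0%N.
have k0 : k.+1%:R != 0 :> rat by apply: natq_neq0.
(* The signed coefficient is multiplied by [1 - p / k.+1]; the terms of order [p^3] and higher are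
   compared. *)
have -> : D k.+1 = D k * (1 - p%:R * k.+1%:R^-1) - esum2 rat k * k.+1%:R^-1.
  have B : 'C(p.-1, k.+1)%:R = (p%:R - k.+1%:R) * 'C(p.-1, k)%:R / k.+1%:R :> rat.
    apply: (mulIf k0); rewrite mulfVK // mulrC -natrM mul_bin_left natrM.
    have -> : (p.-1 - k = p - k.+1)%N by lia.
    by rewrite natrB //; apply: ltnW.
  rewrite /D B hsumS esum2S exprS; move: k.+1%:R k0 => y y0.
  by field; rewrite p_neq0 y0.
have iV : p_integral p k.+1%:R^-1 by apply: p_integralV; lia.
apply: p_integralB; apply: p_integralM => //; first by apply: IHk; lia.
  apply: p_integralB; first exact: p_integral_nat 1%N.
  by apply: p_integralM => //; apply: p_integral_nat.
by case: (reduces_esum2 k (ltnW kp)).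
Qed.

Let nzq m : (0 < m <= p.-1)%N -> m%:R != 0 :> rat.
Proof. by move=> mp; apply: natq_neq0; lia. Qed.

Lemma binomial_expansion z :
  \sum_(1 <= i < p) ((1 - z) ^+ i - 1) / i%:R =
  \sum_(1 <= k < p) z ^+ k / k%:R - p%:R * \sum_(1 <= k < p) hsum rat k 1 * z ^+ k / k%:R
  + p%:R ^+ 2 * \sum_(1 <= k < p) esum2 rat k * z ^+ k / k%:R
  + p%:R ^+ 3 * \sum_(1 <= k < p) D k * z ^+ k / k%:R.
Proof.
rewrite !mulr_sumr -sumrB -!big_split /=.
have := bintrans_expr_div rat z p.-1 p.-1 nzq (leqnn _); rewrite /bintrans pE => <-.
apply: eq_big_nat => k kp; rewrite /D.
have k0 : k%:R != 0 :> rat by apply: natq_neq0; lia.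
by field; rewrite p_neq0 k0.
Qed.

Let H1 := hsum rat p.-1 1.

Lemma hsum1_congr :
  p_integral p ((3%:R * H1 + p%:R ^+ 2 * Cq) / p%:R ^+ 3).
Proof.
pose R := \sum_(1 <= k < p) D k * 1 ^+ k / k%:R.
have := binomial_expansion 1.
have -> : \sum_(1 <= i < p) ((1 - 1) ^+ i - 1) / i%:R = - H1.
  rewrite /H1 /hsum pE -sumrN; apply: eq_big_nat => -[|i] ip //.
  by rewrite subrr exprS mul0r expr1; ring.
have -> : \sum_(1 <= k < p) 1 ^+ k / k%:R = H1.
  by rewrite /H1 /hsum pE; apply: eq_bigr => i _; rewrite expr1n expr1.
have -> : \sum_(1 <= k < p) hsum rat k 1 * 1 ^+ k / k%:R = esum2 rat p.-1 + hsum rat p.-1 2.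
  rewrite /esum2 [X in _ + X]/hsum pE -big_split /=; apply: eq_big_nat => -[|k] kp //.
  by rewrite hsumS expr1n /= !div1r -!exprVn; ring.
have -> : \sum_(1 <= k < p) esum2 rat k * 1 ^+ k / k%:R = esum3 rat p.-1 + Cq.
  rewrite /esum3 /Cq pE -big_split /=; apply: eq_big_nat => -[|k] kp //.
  by rewrite esum2S expr1n /= -!exprVn; ring.
rewrite -/R => HB.
have N2 := newton2 rat p.-1; rewrite -/H1 in N2.
have := hsum1_hsum2_congr; rewrite -/H1; set A := (X in p_integral p X) => iA.
have A2 : p%:R * hsum rat p.-1 2 = p%:R ^+ 3 * A - 2%:R * H1 by rewrite /A; field.
(* [HB] is the expansion at [z = 1]; [e_2] is eliminated by Newton's identity and [H_{p-1,2}]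
   through [A]. What remains is integral because p divides [H1] and [e_3(p-1)]. *)
have -> : (3%:R * H1 + p%:R ^+ 2 * Cq) / p%:R ^+ 3 =
   2%:R^-1 * (A + (H1 / p%:R) ^+ 2) - esum3 rat p.-1 / p%:R - R.
  have N2' : esum2 rat p.-1 = (H1 ^+ 2 - hsum rat p.-1 2) / 2%:R.
    by rewrite -N2; field.
  have E : 3%:R * H1 + p%:R ^+ 2 * Cq =
    2%:R^-1 * p%:R ^+ 3 * A + 2%:R^-1 * p%:R * H1 ^+ 2 - p%:R ^+ 2 * esum3 rat p.-1
    - p%:R ^+ 3 * R.
    have A3 : hsum rat p.-1 2 = (p%:R ^+ 3 * A - 2%:R * H1) / p%:R by rewrite -A2; field.
    rewrite N2' A3 in HB.
    have -> : Cq = (- H1 - (H1 - p%:R * ((H1 ^+ 2 - (p%:R ^+ 3 * A - 2%:R * H1) / p%:R) / 2%:R +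
      (p%:R ^+ 3 * A - 2%:R * H1) / p%:R)) - p%:R ^+ 3 * R) / p%:R ^+ 2 - esum3 rat p.-1.
      by rewrite HB; field.
    by field.
  by rewrite E; field.
have iH : p_integral p (H1 / p%:R) by apply: p_integral_hsum_div; lia.
apply: p_integralB; first apply: p_integralB; last 2 first.
- exact: p_integral_esum3_div.
- apply: p_integral_sum => k kp; rewrite expr1n mulr1; apply: p_integralM.
    by apply: p_integral_bin_expansion; lia.
  exact: p_integralV.
apply: p_integralM; first by apply: p_integralV; lia.
by apply: p_integralD => //; apply: p_integralX.
Qed.

Lemma hsum_half3_congr :
  p_integral p ((hsum rat p./2 3 + 2%:R * Cq) / p%:R).
Proof.
(* [p ^ 2 * r k] is the second-order remainder of 1/(p-k)^2 in powers of p. *)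
pose r k : rat := (3%:R * k%:R - 2%:R * p%:R) * (k%:R^-1 ^+ 3 * (p - k)%:R^-1 ^+ 2).
have rE k : (0 < k < p)%N ->
    1 / (p - k)%:R ^+ 2 =
      1 / k%:R ^+ 2 + 2%:R * p%:R * (1 / k%:R ^+ 3) + p%:R ^+ 2 * r k :> rat.
  move=> kp; have k0 : k%:R != 0 :> rat by apply: natq_neq0; lia.
  have := natq_neq0 (p - k); rewrite /r natrB; last by lia.
  by move=> /(_ ltac:(lia)) pk0; field; rewrite k0 pk0.
have ir k : (0 < k < p)%N -> p_integral p (r k).
  move=> kp; apply: p_integralM.
    apply: p_integralB; apply: p_integralM; exact: p_integral_nat.
  by apply: p_integralM; apply/p_integralX/p_integralV; lia.
pose h := p./2; have ph : p = h.*2.+1 by rewrite /h; lia.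
pose R1 := \sum_(1 <= k < h.+1) r k.
pose R2 := \sum_(1 <= k < h.+1) r k.*2.
(* H_{p-1,2} is expanded in two ways: the indices above p/2 are reflected, and
   then the odd ones. Eliminating H_{h,2} leaves 3 H_{p-1,2} = - p H_{h,3}. *)
have low_high : hsum rat p.-1 2 =
    2%:R * hsum rat h 2 + 2%:R * p%:R * hsum rat h 3 + p%:R ^+ 2 * R1.
  rewrite {1}/hsum pE (@big_cat_nat _ _ _ h.+1) //=; last by lia.
  have -> : \sum_(h.+1 <= k < p) 1 / k%:R ^+ 2 =
            \sum_(1 <= k < h.+1) 1 / (p - k)%:R ^+ 2 :> rat.
    rewrite big_nat_rev /= (big_addn 1 _ h) (_ : (p - h = h.+1)%N); last by lia.
    by apply: eq_big_nat => k kp; congr (1 / _%:R ^+ 2); lia.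
  have -> : \sum_(1 <= k < h.+1) 1 / (p - k)%:R ^+ 2 =
    hsum rat h 2 + 2%:R * p%:R * hsum rat h 3 + p%:R ^+ 2 * R1.
    rewrite !mulr_sumr -!big_split /=; apply: eq_big_nat => k kh.
    by rewrite rE //; lia.
  by rewrite -/(hsum rat h 2); ring.
have even_odd : hsum rat p.-1 2 =
    2%:R^-1 * hsum rat h 2 + 4%:R^-1 * p%:R * hsum rat h 3 + p%:R ^+ 2 * R2.
  have sE := sum_even rat (fun i => 1 / i%:R ^+ 2) h.
  have sO := sum_even rat (fun i => 1 / (p - i)%:R ^+ 2) h.
  rewrite -ph in sE sO.
  (* As [i] and [p - i] have opposite parity, their weights add up to 2. *)
  have : \sum_(1 <= i < p) (1 + (-1) ^+ i) * (1 / i%:R ^+ 2) +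
         \sum_(1 <= i < p) (1 + (-1) ^+ i) * (1 / (p - i)%:R ^+ 2) =
         2%:R * hsum rat p.-1 2.
    rewrite [X in _ + X]sum_reflect /hsum pE mulr_sumr -big_split /=.
    apply: eq_big_nat => k kp.
    rewrite subKn; last by lia.
    rewrite -(signr_odd _ (p - k)) oddB ?p_odd; last by lia.
    by rewrite -(signr_odd _ k) /=; case: (odd k) => /=; ring.
  rewrite sE sO -mulrDr => H.
  have <- : \sum_(1 <= i < h.+1) 1 / i.*2%:R ^+ 2 +
         \sum_(1 <= i < h.+1) 1 / (p - i.*2)%:R ^+ 2 = hsum rat p.-1 2.
    by apply: (@mulfI rat 2%:R) => //.
  rewrite !mulr_sumr -!big_split /=; apply: eq_big_nat => k kh.
  rewrite rE; last by lia.
  have k0 : k%:R != 0 :> rat by apply: natq_neq0; lia.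
  by rewrite -muln2 natrM; field; rewrite k0.
have iP := hsum1_hsum2_congr; have iB := hsum1_congr.
(* The coefficients -3 and 2 make [H_{p-1}] cancel and leave [- 3 H_{p-1,2} / p^2 + 2 Cq / p]. *)
have -> : (hsum rat p./2 3 + 2%:R * Cq) / p%:R =
   4%:R * R2 - R1
   - 3%:R * ((2%:R * hsum rat p.-1 1 + p%:R * hsum rat p.-1 2) / p%:R ^+ 3)
   + 2%:R * ((3%:R * H1 + p%:R ^+ 2 * Cq) / p%:R ^+ 3).
  have -> : hsum rat p./2 3 =
    (- 3%:R * hsum rat p.-1 2 + p%:R ^+ 2 * (4%:R * R2 - R1)) / p%:R.
    have -> : - 3%:R * hsum rat p.-1 2 = hsum rat p.-1 2 - 4%:R * hsum rat p.-1 2 by ring.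
    by rewrite {1}low_high even_odd -/h; field.
  by rewrite /H1; field.
have iR1 : p_integral p R1 by apply: p_integral_sum => k kh; apply: ir; lia.
have iR2 : p_integral p R2 by apply: p_integral_sum => k kh; apply: ir; lia.
apply: p_integralD; last by apply: p_integralM => //; apply: p_integral_nat.
apply: p_integralB; last by apply: p_integralM => //; apply: p_integral_nat.
by apply: p_integralB => //; apply: p_integralM => //; apply: p_integral_nat.
Qed.

Let C : K := \sum_(1 <= i < p) hsum K i.-1 1 / i%:R ^+ 2.

Lemma reduces_sum_hsum : reduces Cq C.
Proof.
apply: reduces_sum => // k kn; apply: reducesM => //.
  by apply: reduces_hsum; lia.
by rewrite -!exprVn; apply: reducesX => //; apply: reducesV_lt; lia.
Qed.

Let C_bernoulli : C = b (p - 3).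
Proof. exact: sum_hsum_bernoulli K p pcharK p_gt5 b b0 ratr_bernoulli_rec. Qed.

Lemma hsum_half3 : hsum K p./2 3 = - 2%:R * C.
Proof.
have [_ H0] := (reduces0P K p pcharK _).2 hsum_half3_congr.
have [_] : reduces (hsum rat p./2 3 + 2%:R * Cq) (hsum K p./2 3 + 2%:R * C).
  apply: reducesD => //; first by apply: reduces_hsum; lia.
  by apply: reducesM => //; [apply: reduces_nat | apply: reduces_sum_hsum].
by rewrite H0 => /esym/eqP; rewrite addr_eq0 mulNr => /eqP.
Qed.

(** * The two congruences *)

Let B := bernoulli (p - 3).

Let rB : reduces B (b (p - 3)).
Proof. by apply: reduces_bernoulli; lia. Qed.

Let reducesV_expn2 k : reduces (2%:R ^+ k)^-1 (2%:R ^+ k)^-1.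
Proof. by rewrite -!exprVn; apply: reducesX => //; apply: reducesV_lt; lia. Qed.

Let reduces_expn2 (f : nat -> rat) (g : nat -> K) :
  (forall k, (k < p)%N -> reduces (f k) (g k)) ->
  reduces (\sum_(1 <= k < p) f k / (k%:R * 2%:R ^+ k))
          (\sum_(1 <= k < p) g k / (k%:R * 2%:R ^+ k)).
Proof.
move=> fg; apply: reduces_sum => // k kp; rewrite !invfM.
apply: reducesM => //; first by apply: fg; lia.
by apply: reducesM => //; apply: reducesV_lt; lia.
Qed.

Let reducesV8 : reduces 8%:R^-1 8%:R^-1.
Proof.
by apply: reducesV_nat => //; rewrite (coprimeXr 3 (coprime_lt_prime 2 _)) //; lia.
Qed.

Lemma rat_eqmod_reduces x x' y : reduces x y -> reduces x' y -> rat_eqmod p 1 x x'.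
Proof.
move=> rx rx'; split; [by case: rx | by case: rx' |].
exists ((x - x') / p%:R); last by rewrite expr1 [RHS]mulrC mulfVK.
by apply/(reduces0P K p pcharK); rewrite -(subrr y); apply: reducesB.
Qed.

Lemma sum_hsum2_congr :
  rat_eqmod p 1 (\sum_(1 <= k < p) hsum rat k 2 / (k%:R * 2%:R ^+ k))
    (- (3%:R / 8%:R) * B).
Proof.
have rS := reduces_expn2 _ _ (fun k => reduces_hsum k 2).
rewrite (sum_hsum2_eq K p pcharK p_gt5 hsum_pred hsum_half3) -/C C_bernoulli in rS.
have rR : reduces (- (3%:R / 8%:R) * B) (- (3%:R / 8%:R) * b (p - 3)).
  apply: reducesM => //; apply: reducesN => //; apply: reducesM => //.
  exact: reduces_nat.
exact: rat_eqmod_reduces rS rR.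
Qed.

Lemma sum_hsum1_congr :
  rat_eqmod p 2 (\sum_(1 <= k < p) hsum rat k 1 / (k%:R * 2%:R ^+ k))
    (7%:R / 24%:R * p%:R * B).
Proof.
set S := \sum_(1 <= k < p) _.
pose W : rat := \sum_(1 <= k < p) esum2 rat k / (k%:R * 2%:R ^+ k).
pose R : rat := \sum_(1 <= k < p) D k / (k%:R * 2%:R ^+ k).
have rW : reduces W (5%:R / 8%:R * b (p - 3)).
  rewrite -C_bernoulli -(sum_esum2_eq K p pcharK p_gt5 hsum_pred hsum_half3).
  by apply: reduces_expn2 => k; apply: reduces_esum2.
have iV3 : p_integral p 3%:R^-1 by apply: p_integralV; lia.
have r3 : reduces 3%:R^-1 3%:R^-1 by apply: reducesV_lt; lia.
have r24 : reduces 24%:R^-1 24%:R^-1.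
  by rewrite !(natrM _ 8 3) !invfM; apply: reducesM.
(* In [K] both [C] and [B] become [b (p - 3)], and [5/8 - 1/3 = 7/24]. *)
have rL : reduces (W - Cq / 3%:R - 7%:R / 24%:R * B) 0.
  have -> : 0 = 5%:R / 8%:R * b (p - 3) - C / 3%:R - 7%:R / 24%:R * b (p - 3).
    have n2 : 2%:R != 0 :> K by rewrite (natf_neq0_lt_char K p) //; lia.
    have n3 : 3%:R != 0 :> K by rewrite (natf_neq0_lt_char K p) //; lia.
    have n8 : 8%:R != 0 :> K by rewrite (natrX _ 2 3) expf_neq0.
    have n24 : 24%:R != 0 :> K by rewrite (natrM _ 8 3) mulf_neq0.
    by rewrite C_bernoulli; field; rewrite n3 n8 n24.
  apply: reducesB => //; first apply: reducesB => //.
    by apply: reducesM => //; apply: reduces_sum_hsum.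
  by apply: reducesM => //; apply: reducesM => //; apply: reduces_nat.
have iR : p_integral p R.
  apply: p_integral_sum => k kp; rewrite invfM; apply: p_integralM.
    by apply: p_integral_bin_expansion; lia.
  by apply: p_integralM; [apply: p_integralV | case: (reducesV_expn2 k)].
have iS : p_integral p S by case: (reduces_expn2 _ _ (fun k => reduces_hsum k 1)).
have iB : p_integral p (7%:R / 24%:R * p%:R * B).
  apply: p_integralM; last by case: rB.
  apply: p_integralM; last exact: p_integral_nat.
  by apply: p_integralM; [apply: p_integral_nat | case: r24].
split=> //.
have := binomial_expansion 2%:R^-1.
have T (f : nat -> rat) : \sum_(1 <= k < p) f k * 2%:R^-1 ^+ k / k%:R =
  \sum_(1 <= k < p) f k / (k%:R * 2%:R ^+ k).
  by apply: eq_bigr => k _; rewrite invfM exprVn; ring.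
rewrite !T -/S -/W -/R.
(* As [1 - 1/2 = 1/2], the sum of [1 / (k 2^k)] occurs on both sides and cancels. *)
have -> : \sum_(1 <= i < p) ((1 - 2%:R^-1) ^+ i - 1) / i%:R =
  \sum_(1 <= k < p) 2%:R^-1 ^+ k / k%:R - H1.
  rewrite (_ : 1 - 2%:R^-1 = 2%:R^-1 :> rat) // /H1 /hsum pE -sumrB.
  by apply: eq_bigr => i _; rewrite expr1; ring.
move=> H; have pS : p%:R * S = H1 + p%:R ^+ 2 * W + p%:R ^+ 3 * R.
  have -> : H1 = \sum_(1 <= k < p) 2%:R^-1 ^+ k / k%:R -
    (\sum_(1 <= k < p) 2%:R^-1 ^+ k / k%:R - H1) by ring.
  by rewrite H; ring.
(* In [pS], [H1] is split as [(3 H1 + p^2 Cq) / 3 - p^2 Cq / 3]; division by [p^3] gives the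
   witness. *)
exists (3%:R^-1 * ((3%:R * H1 + p%:R ^+ 2 * Cq) / p%:R ^+ 3) + R
        + (W - Cq / 3%:R - 7%:R / 24%:R * B) / p%:R).
  apply: p_integralD; last exact/(reduces0P K p pcharK).
  by apply: p_integralD => //; apply: p_integralM => //; apply: hsum1_congr.
apply: (mulfI p_neq0); rewrite mulrBr pS; field.
by rewrite p_neq0.
Qed.

End HarmonicCongruences.

Theorem corollary1p2 (p : nat) (p_prime : prime p) (p_gt5 : (5 < p)%N) :
  rat_eqmod p 2
    (\sum_(1 <= k < p) harmonic k / (k%:R * 2 ^+ k))
    (7 / 24 * p%:R * bernoulli (p - 3)) /\
  rat_eqmod p 1
    (\sum_(1 <= k < p) gen_harmonic k 2 / (k%:R * 2 ^+ k))
    (- (3 / 8) * bernoulli (p - 3)).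
Proof.
(* [K] becomes the prime field ['F_p]; the harmonic numbers of the statement unfold to
   [hsum rat]. *)
have pcharFp := pchar_Fp p_prime; split.
  exact: sum_hsum1_congr pcharFp p_gt5.
exact: sum_hsum2_congr pcharFp p_gt5.
Qed.
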